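(* There exist three distinct primes $p_1$, $p_2$, and $r$, and an infinite family of finite solvable CDGs $G_1, G_2, \dots$, such that, for every $i \geq 1$, $G_i$ has Fitting height $i+1$ and $G_i$ is a $\{p_1, p_2, r\}$-group.
   Context: All groups are finite. For a group $G$, $\mathrm{Irr}(G)$ is the set of irreducible complex characters of $G$ and $\mathrm{cd}(G) = \{\chi(1) \mid \chi \in \mathrm{Irr}(G)\}$. A group $G$ is a composite degree group (CDG) if $1$ is the only prime power lying in $\mathrm{cd}(G)$; here $1$ counts as a prime power, so the condition says that no element of $\mathrm{cd}(G)$ has the form $p^a$ with $p$ prime and $a \geq 1$. The Fitting height of a solvable group $G$ is the least $n$ with $F_n(G) = G$, where $F_0(G) = 1$ and $F_{i+1}(G)/F_i(G)$ is the Fitting subgroup of $G/F_i(G)$. For a set $\pi$ of primes, a $\pi$-group is a group all of whose order's prime divisors lie in $\pi$. *)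

(* Defs.v *)
From mathcomp Require Import all_boot all_order all_algebra.
From mathcomp Require Import all_fingroup all_solvable all_field all_character.

Set Implicit Arguments.
Unset Strict Implicit.
Unset Printing Implicit Defensive.

Import GroupScope GRing.Theory.

(* Complex characters are taken over algC, as in character.v; character
   degrees are natural numbers, so cd(G) is a collective predicate on nat. *)
Definition cd (gT : finGroupType) (G : {group gT}) : nat_pred :=
  [pred n : nat | [exists i : Iirr G, ('chi[G]_i 1%g == n%:R)%R]].

(* The exponent 0 is allowed: 1 counts as a prime power. *)
Definition prime_power (n : nat) : Prop :=
  exists p a : nat, prime p /\ n = (p ^ a)%N.

Definition composite_degree_group (gT : finGroupType) (G : {group gT}) : Prop :=
  forall n : nat, n \in cd G -> prime_power n -> n = 1%N.

(* The ascending Fitting series, in the style of upper_central_at. *)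
Definition fitting_series (n : nat) (gT : finGroupType) (A : {set gT}) :
    {set gT} :=
  iter n (fun B : {set gT} => coset B @*^-1 'F(A / B)) 1.

Definition is_fitting_height (gT : finGroupType) (G : {group gT}) (n : nat) :
    Prop :=
  fitting_series n G = G /\
  forall m : nat, fitting_series m G = G -> (n <= m)%N.

(* Main.v *)
Require Import Defs.
From mathcomp Require Import all_boot all_order all_algebra.
From mathcomp Require Import all_fingroup all_solvable all_field all_character.

(* We take p1 = 3, p2 = 5, r = 2 and build the groups inductively, with the
   Fitting subgroup alternately a 3-group and a 5-group. If F(G) is an s-group,
   put K = G x Z/r, let t be the other prime of {p1, p2} and let W be the
   regular F_t[K]-module. The submodule V = [W, O_s(K), O_r(K)] satisfies
   [V, O_s(K)] = V = [V, O_r(K)], so by Clifford's theorem every irreducible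
   character of V ><| K that is nontrivial on V has degree divisible by both s
   and r; the others are characters of K, whose degrees are those of G. Since K
   acts faithfully on V and O_t(K) = 1, the Fitting subgroup of V ><| K is V,
   so the Fitting height is one more than that of K, i.e., of G. *)

Set Implicit Arguments.
Unset Strict Implicit.
Unset Printing Implicit Defensive.

Import GroupScope GRing.Theory.

(** * The Fitting series, read from the bottom *)

(* [fitting_series n] packaged as a group functor, to inherit its naturality. *)
Fixpoint fitting_pmap (n : nat) : GFunctor.pmap :=
  if n is m.+1 then gFmod_pgFun Fitting_pgFun (fitting_pmap m)
  else trivGfun_pgFun.

Lemma fitting_pmapE n (gT : finGroupType) (A : {set gT}) :
  fitting_pmap n gT A = fitting_series n A.
Proof. by elim: n => //= n IHn; rewrite /GFunctor.modulo IHn. Qed.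

(** The third isomorphism from [G / N / (B / N)] to [G / B] carries Fitting subgroup to Fitting
    subgroup, so both have the same preimage in [G]. *)
Lemma cosetpre_Fitting_third (gT : finGroupType) (G B N : {group gT}) :
    N <| G -> B <| G -> N \subset B ->
  coset B @*^-1 'F(G / B)
    = coset N @*^-1 (coset (B / N) @*^-1 'F(G / N / (B / N))).
Proof.
move=> nsNG nsBG sNB; have nsBN: B / N <| G / N by rewrite quotient_normal.
have [f injf imf] := third_isom sNB nsNG nsBG.
set C2 := RHS.
have sC2G: C2 \subset G.
  by rewrite sub_cosetpre_quo // sub_cosetpre_quo // Fitting_sub.
have sBC2: B \subset C2.
  rewrite -sub_quotient_pre ?(subset_trans (normal_sub nsBG)) ?normal_norm //.
  exact: sub_cosetpre.
have C2q : C2 / N / (B / N) = 'F(G / N / (B / N)) by rewrite !cosetpreK.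
have C2B : C2 / B = 'F(G / B).
  rewrite -imf // C2q injmF //= imf //.
by rewrite -C2B quotientGK // /normal sBC2 (subset_trans sC2G) ?normal_norm.
Qed.

(** The definition adds a layer at the top; peeling one off at the bottom instead lets inductions
    pass to [G / 'F(G)]. *)
Lemma fitting_seriesS (n : nat) (gT : finGroupType) (G : {group gT}) :
  fitting_series n.+1 G = coset 'F(G) @*^-1 (fitting_series n (G / 'F(G))).
Proof.
elim: n => [|n IHn].
  rewrite /= cosetpre1 -[G / 1]/(coset 1 @* G) -injmF ?norms1 ?coset1_injm //.
  by rewrite quotientGK // /normal sub1G norms1.
pose N := 'F(G)%G; pose B' := [group of fitting_pmap n _ (G / N)].
pose B := (coset N @*^-1 B')%G.
have sNB : N \subset B := sub_cosetpre _.
have nsB : B <| G.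
  by rewrite -(quotientGK (Fitting_normal G)) cosetpre_normal gFnormal.
have BE : fitting_series n.+1 G = B by rewrite IHn /= fitting_pmapE.
rewrite [LHS]/fitting_series iterS -/(fitting_series _ _) BE.
rewrite (cosetpre_Fitting_third (Fitting_normal G)) //.
by rewrite cosetpreK /= fitting_pmapE.
Qed.

(** * Clifford theory and divisibility of degrees *)

Section CharacterDegrees.

Local Open Scope ring_scope.

(** By Clifford, the restriction to [H] is a multiple of the sum over the [G]-orbit of ['chi_j]; the
    orbit has the inertia index as its size, and conjugates share their degree. *)
Lemma dvdn_index_inertia_irr1 (gT : finGroupType) (G H : {group gT})
    (i : Iirr G) (j : Iirr H) :
    H <| G -> j \in irr_constt ('Res[H] 'chi_i)%R ->
  exists n, 'chi_i 1%g = ((n * #|G : 'I_G['chi_j]%CF|)%:R * 'chi_j 1%g)%R.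
Proof.
move=> nsHG chiHj; have [sHG nHG] := andP nsHG; rewrite -(cfResE _ sHG) //.
rewrite {1}(Clifford_Res_sum_cfclass nsHG chiHj) cfunE sum_cfunE.
have /Num.Theory.natrP[n ->]: ('['Res[H] 'chi_i, 'chi_j])%R \in Num.nat.
  by rewrite Cnat_cfdot_char ?cfRes_char ?irr_char.
exists n; rewrite natrM -mulrA -size_cfclass; congr (_ * _)%R.
rewrite mulr_natl -[size _]card_ord big_tnth -sumr_const.
apply: eq_bigr => k _.
by have /cfclassP[y Gy ->]:=  mem_tnth k (in_tuple _); rewrite cfConjg1.
Qed.

(** Suppose [p] does not divide [n], and let ['chi_k] be a constituent on [V], below a constituent
    on [X]. Its inertia index in [X] is a power of [p] dividing [n], hence 1. An [X]-invariant
    linear character is trivial on [[~: V, X] = V], so ['chi_k] is principal and [V] lies in the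
    kernel of ['chi_i]. *)
Lemma dvdn_irr1_commg (gT : finGroupType) (G X V : {group gT}) (p n : nat)
    (i : Iirr G) :
    prime p -> X <| G -> V <| G -> V \subset X -> p.-group (X / V)%g ->
    abelian V -> [~: V, X] = V ->
    ~~ (V \subset cfker 'chi_i) -> 'chi_i 1%g = n%:R -> (p %| n)%N.
Proof.
move=> p_pr nsXG nsVG sVX pXV abV VXV nkerV chi1n.
apply: contraR nkerV => p'n.
have nsVX : V <| X := normalS sVX (normal_sub nsXG) nsVG.
have [j Xj] := constt_cfRes_irr X i.
have [k Vk] := constt_cfRes_irr V j.
have [a chi1] := dvdn_constt_Res1_irr1 nsXG Xj.
have [b psi1] := dvdn_index_inertia_irr1 nsVX Vk.
have lin_k : 'chi_k \is a linear_char by apply/char_abelianP.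
have chik1 := lin_char1 lin_k.
have sXI : X \subset 'I['chi_k]%CF.
  apply/setIidPl/eqP; rewrite eqEsubset subsetIl -indexg_eq1 //.
  have pI : p.-nat #|X : X :&: 'I['chi_k]%CF|.
    apply: pnat_dvd pXV; rewrite card_quotient ?normal_norm //.
    by rewrite indexgS // subsetI sVX sub_inertia.
  apply/eqP/(pnat_1 pI).
  rewrite p'natE //; apply: contra p'n => /dvdn_trans-> //.
  move/eqP: chi1; rewrite chi1n psi1 chik1 mulr1 -!natrM.
  rewrite Num.Theory.eqr_nat => /eqP ->.
  by rewrite mulnA dvdn_mull.
have Vker : V \subset cfker 'chi_k.
  suffices: [~: V, X] \subset cfker 'chi_k by rewrite VXV.
  rewrite gen_subG; apply/subsetP=> _ /imset2P[v x Vv Xx ->].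
  have Vvx : (v ^ x)%g \in V by rewrite memJ_norm ?(subsetP (normal_norm nsVX)).
  rewrite /= cfkerEirr inE commgEl lin_charM ?groupV // lin_charV //.
  rewrite inertia_valJ ?(subsetP sXI) // mulVf ?lin_char_neq0 //.
  by rewrite chik1.
move: Vk; have /eqP-> : k == 0%R by rewrite -subGcfker.
move=> V0; apply: constt0_Res_cfker nsVG _.
rewrite -(cfResRes _ sVX) ?normal_sub //.
apply: constt_Res_trans V0 => //.
by rewrite cfRes_char ?irr_char.
Qed.

End CharacterDegrees.

(** * The regular module and its commutator submodule *)

Section RegularModule.

Local Open Scope ring_scope.

(* W is written multiplicatively: w is the basis vector of the regular module
   at the identity of L, and phi the coordinate along it. *)
Definition regular_vector (gT : finGroupType) (W L : {set gT}) (q : nat)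
    (w : gT) (phi : gT -> 'F_q) : Prop :=
  [/\ w \in W,
      {in W &, {morph phi : x y / (x * y)%g >-> x + y}}
    & {in L, forall k, phi (w ^ k)%g = (k == 1%g)%:R}].

Lemma regular_sdprod (gT : finGroupType) (K : {group gT}) (q : nat) :
    prime q ->
  {sT : finGroupType & {W : {group sT} & {L : {group sT} |
    [/\ K \isog L, q.-abelem W, W ><| L = [set: sT]
      & exists w phi, @regular_vector sT W L q w phi]}}}.
Proof.
move=> q_pr; pose aK := regular_repr 'F_q K.
pose to := ('MR aK)%gact; exists (sdprod_by to).
exists (sdpair1 to @* setT)%G, (sdpair2 to @* K)%G; split.
- by apply: (sub_isog (subxx K)) (injm_sdpair2 to).
- by rewrite injm_abelem ?injm_sdpair1 ?mx_Fp_abelem.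
- exact: sdprod_sdpair.
(* Acting by [k] turns the basis row [e] of the identity into that of [k], so the coordinate at [e1]
   detects [k = 1]. *)
pose e1 := gring_index K 1%g.
pose e : 'rV['F_q]_#|K| := delta_mx 0 e1.
pose inv := invm (injm_sdpair1 to).
exists (sdpair1 to e), (fun x => (inv x) 0 e1); split.
- by rewrite mem_morphim ?inE.
- by move=> x y Wx Wy /=; rewrite [inv _]morphM // mxE.
move=> _ /morphimP[k Kk _ ->].
rewrite -sdpair_act ?inE // /inv invmE ?inE //.
rewrite /= mx_repr_actE // -rowE rowK gring_indexK ?mul1g // mxE eqxx.
rewrite morph_injm_eq1 ?injm_sdpair2 //.
by rewrite -(inj_in_eq (can_in_inj (@gring_indexK _ K))) // eq_sym.
Qed.

(** [A] centralizes [G / [~: G, A]], and in a coprime action the fixed points of a quotient lift to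
    ['C_G(A)]. *)
Lemma coprime_TIcent_comm (gT : finGroupType) (A G : {group gT}) :
    A \subset 'N(G) -> coprime #|G| #|A| -> solvable G -> 'C_G(A) = 1%g ->
  [~: G, A] = G.
Proof.
move=> nGA coGA solG CGA; apply/eqP; rewrite eqEsubset commg_subl nGA /=.
have nRG : G \subset 'N([~: G, A]) := commg_norml G A.
have cGA : (G / [~: G, A])%g \subset 'C(A / [~: G, A]).
  by rewrite quotient_cents2r.
rewrite -quotient_sub1 // -(setIidPl cGA).
rewrite -coprime_quotient_cent ?commg_subl ?commg_normr //.
by rewrite CGA quotient1.
Qed.

Section RegularVector.

Variables (gT : finGroupType) (W L : {group gT}) (q : nat).
Variables (w : gT) (phi : gT -> 'F_q).
Hypotheses (nWL : L \subset 'N(W)) (wphi : @regular_vector gT W L q w phi).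

Lemma regular_vector_commg y a g :
    y \in W -> a \in L -> g \in L ->
  phi ([~ y, a] ^ g)%g = phi (y ^ (a * g))%g - phi (y ^ g)%g.
Proof.
have [_ phiM _] := wphi => Wy La Lg.
have WJ z h : z \in W -> h \in L -> (z ^ h)%g \in W.
  by move=> Wz Lh; rewrite memJ_norm ?(subsetP nWL).
have phi1 : phi 1%g = 0.
  by apply: (@addrI _ (phi 1%g)); rewrite -phiM ?group1 // mulg1 addr0.
have phiV z : z \in W -> phi z^-1%g = - phi z.
  move=> Wz; apply: (@addrI _ (phi z)).
  by rewrite -phiM ?groupV // mulgV phi1 subrr.
rewrite commgEl conjMg -conjgM phiM ?WJ ?groupV ?groupM //.
by rewrite conjVg phiV ?WJ // addrC.
Qed.

Hypotheses (q_odd : odd q) (q_pr : prime q).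

Lemma cent_regular_vector_commg u c k :
    u \in L -> c \in L -> k \in L -> (u != 1)%g -> (c != 1)%g ->
    (u != c)%g -> (u * c != 1)%g -> (k != 1)%g ->
  commute [~ w, u, c] k -> k = (u * c)^-1%g.
Proof.
have [Ww phiM phiw] := wphi => Lu Lc Lk nt_u nt_c neq_uc nt_uc nt_k cxk.
have phix g : g \in L ->
  phi ([~ w, u, c] ^ g)%g = ((u * c * g == 1)%g%:R - (c * g == 1)%g%:R)
                            - ((u * g == 1)%g%:R - (g == 1)%g%:R).
  move=> Lg; have Wwu : [~ w, u] \in W.
    by rewrite commgEl groupMl ?groupV // memJ_norm ?(subsetP nWL).
  rewrite regular_vector_commg // !regular_vector_commg ?groupM //.
  by rewrite !phiw ?groupM // !mulgA.
have := phix k Lk; rewrite conjgE cxk mulKg -[[~ w, u, c]]conjg1 phix // !mulg1.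
rewrite (negPf nt_uc) (negPf nt_c) (negPf nt_u) (negPf nt_k) eqxx /= !subr0.
rewrite !sub0r opprK.
have [/eqP | _] := eqVneq (u * c * k)%g 1%g.
  by rewrite -eq_invg_mul => /eqP.
have neq1N1 : (1 == -1 :> 'F_q) = false.
  rewrite -addr_eq0 -mulr2n -(dvdn_pcharf (pchar_Fp q_pr)).
  by rewrite dvdn_prime2 ?gtn_eqF ?odd_prime_gt2.
have [ck1 | _] := eqVneq (c * k)%g 1%g; have [uk1 | _] := eqVneq (u * k)%g 1%g.
- by case/eqP: neq_uc; apply: (mulIg k); rewrite uk1 ck1.
- by rewrite subr0 sub0r => /eqP; rewrite neq1N1.
- by rewrite subr0 sub0r => /eqP; rewrite neq1N1.
- by rewrite !subr0 => /eqP; rewrite oner_eq0.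
Qed.

Lemma regular_vector_commg_module (U C : {group gT}) (V := [~: W, U, C]) :
    q.-abelem W -> U <| L -> C <| L -> coprime #|U| #|C| -> odd #|U| ->
    coprime q #|U| -> coprime q #|C| -> (U :!=: 1)%g -> (C :!=: 1)%g ->
  [/\ [/\ V \subset W, L \subset 'N(V) & 'C_L(V) = 1%g],
      [~: V, U] = V & [~: V, C] = V].
Proof.
move=> abelW nsUL nsCL coUC oddU coqU coqC ntU ntC.
have [[sUL nUL] [sCL nCL]] := (andP nsUL, andP nsCL).
have [qW abW _] := and3P abelW.
have nWU := subset_trans sUL nWL; have nWC := subset_trans sCL nWL.
have coW (X A : {group gT}) :
  X \subset W -> coprime q #|A| -> coprime #|X| #|A|.
  move=> sXW coqA; have /pnat_coprime-> // : q.-group X := pgroupS sXW qW.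
  by rewrite p'natE // -prime_coprime.
have sWUW : [~: W, U] \subset W by rewrite commg_subl.
have nWUL : L \subset 'N([~: W, U]) by rewrite normsR.
have nWUC := subset_trans sCL nWUL.
have sVWU : V \subset [~: W, U] by rewrite commg_subl.
have sVW := subset_trans sVWU sWUW.
have nVL : L \subset 'N(V) by rewrite normsR.
have nVU := subset_trans sUL nVL; have nVC := subset_trans sCL nVL.
have abV : abelian V := abelianS sVW abW.
(* By coprime action on an abelian group, [U] has no nontrivial fixed point in [[~: W, U]], nor [C]
   in [V]. *)
have VU : [~: V, U] = V.
  rewrite coprime_TIcent_comm ?coW ?abelian_sol //.
  by apply/trivgP; rewrite -(coprime_abel_cent_TI nWU) ?coW // setSI.
have VC : [~: V, C] = V.
  rewrite coprime_TIcent_comm ?coW ?abelian_sol //.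
  by rewrite coprime_abel_cent_TI ?coW // (abelianS sWUW).
split=> //; split=> //.
have [[u Uu ntu] [c Cc ntc]] := (trivgPn _ ntU, trivgPn _ ntC).
have TI : U :&: C = 1%g := coprime_TIg coUC.
have cuc : commute u c.
  apply: (centP _ _ Cc); move: u Uu {ntu}; apply/subsetP.
  have : [~: U, C] = 1%g.
    apply/trivgP; rewrite -TI subsetI.
    by rewrite commg_subl commg_subr (subset_trans sCL) // (subset_trans sUL).
  by move/commG1P.
have xV : [~ w, u, c] \in V by have [Ww _ _] := wphi; rewrite !mem_commg.
have [Lu Lc] := (subsetP sUL u Uu, subsetP sCL c Cc).
have nteq : u != c.
  by apply: contraNneq ntu => uc; apply/eqP/set1gP; rewrite -TI inE Uu uc.
have ntuc : (u * c != 1)%g.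
  apply: contraNneq ntu => /eqP; rewrite -eq_invg_mul => /eqP uc.
  by apply/eqP/set1gP; rewrite -TI inE Uu -groupV uc.
(* Only (u * c)^-1 can be a nontrivial element of L centralizing V; then it is
   an involution, so u ^+ 2 lies in U :&: C, whereas U has odd order. *)
have cent_uc k : k \in 'C_L(V) -> k != 1%g -> k = (u * c)^-1%g.
  case/setIP=> Lk cVk ntk; apply: cent_regular_vector_commg => //.
  by apply/commute_sym/(centP cVk).
apply/trivgP/subsetP=> k Ck; rewrite inE; apply/idPn=> ntk.
(* [k * k] also centralizes [V]; if nontrivial, it would equal [(u * c)^-1], which is [k], forcing
   [k = 1]. *)
have k2 : (k * k)%g = 1%g.
  apply/eqP/idPn=> ntk2.
  have := cent_uc _ (groupM Ck Ck) ntk2; rewrite -(cent_uc k) // => kk.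
  by case/eqP: ntk; apply: (mulgI k); rewrite mulg1.
have uc2 : (u ^+ 2 * c ^+ 2 = 1)%g.
  rewrite -expgMn // -[(u * c)%g]invgK -(cent_uc k) // expgVn.
  by rewrite expgS expg1 k2 invg1.
have u2 : (u ^+ 2 = 1)%g.
  apply/set1gP; rewrite -TI inE groupX //=.
  by move/eqP: uc2; rewrite -eq_invg_mul -groupV => /eqP ->; rewrite groupX.
case/eqP: ntu; apply/eqP; rewrite -order_eq1 -dvdn1.
have <- : gcdn 2 #|U| = 1%N by apply/eqP; rewrite -/(coprime _ _) coprime2n.
by rewrite dvdn_gcd order_dvdG // order_dvdn u2 eqxx.
Qed.

End RegularVector.

End RegularModule.

(** * Transfer of Fitting height and of the CDG property *)

Lemma fitting_series_quotient n (gT : finGroupType) (G : {group gT}) :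
  fitting_series n.+1 G = G
    <-> fitting_series n (G / 'F(G)) = G / 'F(G).
Proof.
rewrite fitting_seriesS; split=> [defG | ->].
  by rewrite -[LHS]cosetpreK defG.
by rewrite quotientGK ?Fitting_normal.
Qed.

Lemma fitting_series_sub n (gT : finGroupType) (H G : {group gT}) :
  H \subset G -> fitting_series n G = G -> fitting_series n H = H.
Proof.
rewrite -!fitting_pmapE => sHG defG.
apply/eqP; rewrite eqEsubset gFsub /=.
by have := gFhereditary (fitting_pmap n) sHG; rewrite defG (setIidPr sHG).
Qed.

Lemma fitting_series_homg n (gT rT : finGroupType) (G : {group gT})
    (H : {group rT}) :
  H \homg G -> fitting_series n G = G -> fitting_series n H = H.
Proof.
case/homgP=> f <-; rewrite -!fitting_pmapE => defG.
apply/eqP; rewrite eqEsubset gFsub /=.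
by have := gFcont (fitting_pmap n) f; rewrite defG.
Qed.

Lemma cdg_isog (gT rT : finGroupType) (G : {group gT}) (H : {group rT}) :
  G \isog H -> composite_degree_group H -> composite_degree_group G.
Proof.
case/isogP=> f injf fG cdgH n /existsP[i /eqP chi1]; apply: cdgH.
have isoGH : isom G H f by apply/isomP.
by apply/existsP; exists (isom_Iirr isoGH i); rewrite isom_IirrE cfIsom1 chi1.
Qed.

Lemma cdg_abelian (gT : finGroupType) (G : {group gT}) :
  abelian G -> composite_degree_group G.
Proof.
move=> abG n /existsP[i /eqP chi1] _; apply/eqP.
by rewrite -(Num.Theory.eqr_nat algC) -chi1 lin_char1 //; apply/char_abelianP.
Qed.

Lemma prime_power_pdiv p q n :
  prime p -> prime q -> p %| n -> q %| n -> prime_power n -> p = q.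
Proof.
move=> p_pr q_pr pn qn [s [a [s_pr def_n]]].
have eqs t : prime t -> t %| n -> t = s.
  by move=> t_pr; rewrite def_n Euclid_dvdX // dvdn_prime2 // => /andP[/eqP].
by rewrite (eqs p p_pr pn) (eqs q q_pr qn).
Qed.

(** * Adjoining an abelian direct factor *)

Section DirectFactor.

Variables (gT : finGroupType) (G A K : {group gT}).
Hypotheses (defK : G \x A = K) (abA : abelian A).

Lemma cdg_dprod_abelian : composite_degree_group G -> composite_degree_group K.
Proof.
move=> cdgG n /existsP[i /eqP chi1]; apply: cdgG; apply/existsP.
exists (inv_dprod_Iirr defK i).1; rewrite -chi1.
rewrite -{2}(inv_dprod_IirrK defK i) dprod_IirrE cfDprod1.
rewrite (@lin_char1 _ _ ('chi_ (inv_dprod_Iirr defK i).2)%R) ?mulr1 //.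
exact/char_abelianP.
Qed.

(** [K / G] is an image of [A], hence a [p']-group, so ['O_p(K)] falls into [G]. *)
Lemma pcore_dprod_p' p : p^'.-group A -> 'O_p(G) = 1 -> 'O_p(K) = 1.
Proof.
have [nsGK nsAK] := dprod_normal2 defK.
move=> p'A OG; apply/trivgP; rewrite -OG pcore_max ?pcore_pgroup //.
suffices sOG : 'O_p(K) \subset G.
  by apply: normalS sOG (normal_sub nsGK) (pcore_normal _ _).
rewrite -quotient_sub1 ?(subset_trans (pcore_sub _ _)) ?normal_norm //.
have p'KG : p^'.-group (K / G).
  by rewrite -(dprodW defK) quotientMidl quotient_pgroup.
have pOG := quotient_pgroup G (pcore_pgroup p K).
rewrite -(coprime_TIg (pnat_coprime pOG p'KG)).
by rewrite subsetI subxx quotientS ?pcore_sub.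
Qed.

(** Since [A] lies in ['F(K)], the group [K / 'F(K)] is an image of [G / 'F(G)]; minimality passes
    up from the subgroup [G]. The height is a successor because a nontrivial [A] would raise height
    0 to 1. *)
Lemma fitting_height_dprod_abelian n :
  is_fitting_height G n.+1 -> is_fitting_height K n.+1.
Proof.
have [nsGK nsAK] := dprod_normal2 defK.
case=> hG minG; split=> [|m hK]; last first.
  by apply: minG; apply: fitting_series_sub hK; apply: normal_sub.
apply/fitting_series_quotient.
move/fitting_series_quotient: hG => hG.
have sFF : 'F(G) \subset 'F(K).
  by rewrite Fitting_max ?Fitting_nil ?gFnormal_trans.
have sAF : A \subset 'F(K) by rewrite Fitting_max ?abelian_nil.
have nFG : G \subset 'N('F(K)).
  by rewrite (subset_trans (normal_sub nsGK)) ?gFnorm.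
have defGF : G * 'F(K) = K.
  apply/eqP; rewrite eqEsubset mul_subG ?Fitting_sub ?(normal_sub nsGK) //=.
  by rewrite -{1}(dprodW defK) mulgS.
have -> : K / 'F(K) = G / 'F(K) by rewrite -(quotientMidr _ G) defGF.
apply: fitting_series_homg hG.
by rewrite homg_quotientS ?gFnorm.
Qed.

End DirectFactor.

(** * Extension by a faithful module *)

Section FaithfulExtension.

Variables (gT : finGroupType) (V L G : {group gT}) (q : nat).
Hypotheses (defG : V ><| L = G) (qV : q.-group V) (abV : abelian V).

(** ['F(G) :&: L] lies in ['F(L)], a [q']-group because ['O_q(L) = 1]. Inside the nilpotent ['F(G)]
    it therefore centralizes the [q]-group [V], so it is trivial by faithfulness; Dedekind's law
    then gives ['F(G) = V]. *)
Lemma Fitting_sdprod_faithful :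
  'C_L(V) = 1 -> 'O_q(L) = 1 -> 'F(G) = V.
Proof.
move=> faithL Lq; have [nsVG sLG defVL nVL tiVL] := sdprod_context defG.
have sVF : V \subset 'F(G) by rewrite Fitting_max ?abelian_nil.
have q'FL : q^'.-group 'F(L).
  have /dprodP[_ /= <- _ _] := nilpotent_pcoreC q (Fitting_nil L).
  by rewrite p_core_Fitting Lq mul1g pcore_pgroup.
have nilFL : nilpotent ('F(G) :&: L).
  exact: nilpotentS (subsetIl _ _) (Fitting_nil G).
have nsFL : 'F(G) :&: L <| L.
  by rewrite setIC; apply: normalGI sLG (Fitting_normal G).
have q'N : q^'.-group ('F(G) :&: L) := pgroupS (Fitting_max nsFL nilFL) q'FL.
have N1 : 'F(G) :&: L = 1.
  apply/trivgP; rewrite -faithL subsetI subsetIr /=.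
  apply: sub_nilpotent_cent2 (Fitting_nil G) sVF (subsetIl _ _) _.
  exact: pnat_coprime qV q'N.
have := group_modl L sVF.
by rewrite setIC N1 mulg1 defVL (setIidPr (Fitting_sub G)) => ->.
Qed.

Lemma dvdn_irr1_sdprod (U : {group gT}) (p n : nat) (i : Iirr G) :
    prime p -> U <| L -> p.-group U -> [~: V, U] = V ->
    ~~ (V \subset cfker 'chi_i)%R -> ('chi_i 1%g == n%:R)%R -> p %| n.
Proof.
move=> p_pr nsUL pU VU nkerV /eqP chi1.
have [nsVG sLG defVL nVL tiVL] := sdprod_context defG.
have nVU := subset_trans (normal_sub nsUL) nVL.
(* Take [X = V <*> U]: it is normal in [G], and [X / V] is an image of the [p]-group [U]. *)
apply: (@dvdn_irr1_commg _ G (V <*> U) V p n i) => //.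
- have sUG := subset_trans (normal_sub nsUL) sLG.
  rewrite /normal join_subG (normal_sub nsVG) sUG /=.
  rewrite -{1}defVL mul_subG //; last exact: normsY nVL (normal_norm nsUL).
  exact: subset_trans (joing_subl V U) (normG _).
- exact: joing_subl.
- by rewrite quotientYidl // quotient_pgroup.
apply/eqP; rewrite eqEsubset commg_subl join_subG normG nVU /=.
by rewrite -{1}VU commgS // joing_subr.
Qed.

Lemma cdg_sdprod (U C : {group gT}) (p1 p2 : nat) :
    prime p1 -> prime p2 -> p1 <> p2 ->
    U <| L -> p1.-group U -> [~: V, U] = V ->
    C <| L -> p2.-group C -> [~: V, C] = V ->
  composite_degree_group L -> composite_degree_group G.
Proof.
move=> p1_pr p2_pr neq12 nsUL p1U VU nsCL p2C VC cdgL n /existsP[i chi1] ppn.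
have [kerV | nkerV] := boolP (V \subset cfker 'chi_i)%R.
  apply: cdgL ppn; apply/existsP; exists (Res_Iirr L i).
  rewrite -(eqP chi1) -{2}(sdprod_Res_IirrK defG kerV).
  by rewrite sdprod_IirrE cfSdprod1.
have p1n := dvdn_irr1_sdprod p1_pr nsUL p1U VU nkerV chi1.
have p2n := dvdn_irr1_sdprod p2_pr nsCL p2C VC nkerV chi1.
by case: neq12; apply: prime_power_pdiv ppn.
Qed.

End FaithfulExtension.

Lemma cdg_extension (gT : finGroupType) (K : {group gT}) (p1 p2 q : nat) :
    prime p1 -> prime p2 -> prime q -> p1 <> p2 -> p1 <> q -> p2 <> q ->
    odd p1 -> odd q -> 'O_p1(K) != 1 -> 'O_p2(K) != 1 -> 'O_q(K) = 1 ->
    composite_degree_group K ->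
  {rT : finGroupType & {G : {group rT} |
    [/\ composite_degree_group G, q.-group 'F(G), 'F(G) != 1
      & K \isog G / 'F(G)]}}.
Proof.
move=> p1_pr p2_pr q_pr neq12 neq1q neq2q odd_p1 odd_q K1 K2 Kq cdgK.
have [sT [W [L [isoKL abelW defWL ex_wphi]]]] := regular_sdprod K q_pr.
pose U := 'O_p1(L)%G; pose C := 'O_p2(L)%G; pose V := [~: W, U, C]%G.
exists sT, (V <*> L)%G.
have [w [phi wphi]] := ex_wphi.
have [_ _ _ nWL tiWL] := sdprod_context defWL.
have ntU : U :!=: 1 by rewrite -(isog_eq1 (gFisog _ isoKL)).
have ntC : C :!=: 1 by rewrite -(isog_eq1 (gFisog _ isoKL)).
have nsUL : U <| L := pcore_normal _ _.
have nsCL : C <| L := pcore_normal _ _.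
have p1U : p1.-group U := pcore_pgroup _ _.
have p2C : p2.-group C := pcore_pgroup _ _.
have coq (A : {group sT}) p : prime p -> p <> q -> p.-group A -> coprime q #|A|.
  move=> p_pr /eqP neq_pq pA; rewrite coprime_sym (pnat_coprime pA) //.
  by rewrite p'natE // dvdn_prime2.
have coUC : coprime #|U| #|C|.
  apply: (pnat_coprime p1U); apply: sub_pgroup p2C => x; rewrite !inE => /eqP->.
  by rewrite eq_sym; apply/eqP.
have oddU : odd #|U|.
  by have [n ->] := p_natP p1U; rewrite oddX odd_p1 orbT.
have [[sVW nVL faithL] VU VC] :=
  regular_vector_commg_module nWL wphi odd_q q_pr abelW nsUL nsCL coUC oddU
    (coq _ _ p1_pr neq1q p1U) (coq _ _ p2_pr neq2q p2C) ntU ntC.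
have [qW abW _] := and3P abelW.
have qV : q.-group V := pgroupS sVW qW.
have abV : abelian V := abelianS sVW abW.
have Lq : 'O_q(L) = 1.
  by apply/eqP; rewrite -(isog_eq1 (gFisog _ isoKL)) /= Kq.
have defG : V ><| L = V <*> L.
  apply: sdprodEY => //; apply/trivgP; rewrite -tiWL; exact: setSI.
have FG := Fitting_sdprod_faithful defG qV abV faithL Lq.
split.
- have cdgL : composite_degree_group L.
    by apply: cdg_isog cdgK; rewrite isog_sym.
  exact: (cdg_sdprod defG abV p1_pr p2_pr neq12 nsUL p1U VU nsCL p2C VC).
- by rewrite FG.
- rewrite FG; apply: contraNneq ntU => V1; rewrite -subG1 -faithL V1.
  by rewrite cent1T setIT (normal_sub nsUL).
by rewrite FG; apply: isog_trans isoKL (sdprod_isog defG).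
Qed.

Lemma fitting_height_isog n (gT rT : finGroupType) (G : {group gT})
    (H : {group rT}) :
  G \isog H -> is_fitting_height G n -> is_fitting_height H n.
Proof.
rewrite isogEhom => /andP[homGH homHG] [hG minG].
split=> [|m hH]; first exact: fitting_series_homg hG.
by apply: minG; apply: fitting_series_homg hH.
Qed.

(** Passing to [G / 'F(G)] shortens the series by one term; for the lower bound, length 0 is
    excluded separately by ['F(G) != 1]. *)
Lemma fitting_height_extension n (gT rT : finGroupType) (K : {group gT})
    (G : {group rT}) :
    'F(G) != 1 -> K \isog G / 'F(G) -> is_fitting_height K n ->
  is_fitting_height G n.+1.
Proof.
rewrite isogEhom => ntF /andP[homKG homGK] [hK minK].
split=> [|[/= G1|m hG]].
- exact/fitting_series_quotient/(fitting_series_homg homGK).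
- case/eqP: ntF; apply/trivgP.
  by apply: subset_trans (Fitting_sub G) _; rewrite -G1.
by apply/minK/(fitting_series_homg homKG)/fitting_series_quotient.
Qed.

(** * The tower of groups *)

(** The induction invariant, with [n] counting the extensions made. Its last component makes ['O_s]
    nontrivial and the core at the other alternating prime trivial, as the next extension
    requires. *)
Definition cdg_tower (pi : nat_pred) (s n : nat) (gT : finGroupType)
    (G : {group gT}) : Prop :=
  [/\ solvable G, composite_degree_group G, is_fitting_height G n.+1,
      pi.-group G & s.-group 'F(G) /\ G :!=: 1].

Lemma cdg_tower_step (pi : nat_pred) (s t r n : nat) (gT : finGroupType)
    (G : {group gT}) :
    prime s -> prime t -> prime r -> s <> t -> s <> r -> t <> r ->
    odd s -> odd t -> t \in pi -> r \in pi -> cdg_tower pi s n G ->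
  {rT : finGroupType & {H : {group rT} | cdg_tower pi t n.+1 H}}.
Proof.
move=> s_pr t_pr r_pr neq_st neq_sr neq_tr odd_s odd_t pi_t pi_r.
case=> solG cdgG hG piG [sF ntG].
(* The abelian factor supplies a nontrivial ['O_r(K)] and leaves the set of degrees unchanged. *)
pose A := Zp r; pose K := setX_group G A.
have oA : #|A| = r by rewrite card_Zp ?prime_gt0.
have abA : abelian (setX_group [1 gT] A).
  by rewrite -(isog_abelian (isog_set1X _ A)) cyclic_abelian ?prime_cyclic ?oA.
have defK : setX_group G [1 'Z_r] \x setX_group [1 gT] A = K := setX_dprod G A.
have isoG : G \isog setX_group G [1 'Z_r] := isog_setX1 _ G.
have isoA : A \isog setX_group [1 gT] A := isog_set1X _ A.
have [nsG nsA] := dprod_normal2 defK.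
have rA : r.-group (setX_group [1 gT] A).
  by rewrite /pgroup -(card_isog isoA) oA pnat_id.
have cdgK : composite_degree_group K.
  apply: cdg_dprod_abelian defK abA _; apply: cdg_isog cdgG.
  by rewrite isog_sym.
(* The Fitting subgroup of the nontrivial solvable factor [G] is a nontrivial normal [s]-subgroup of
   [K]. *)
have Ks : 'O_s(K) != 1.
  have sF1 : s.-group 'F(setX_group G [1 'Z_r]).
    by rewrite /pgroup -(card_isog (gFisog _ isoG)).
  apply: contraNneq ntG => Ks1; rewrite (isog_eq1 isoG) -trivg_Fitting.
    by rewrite -subG1 -Ks1 pcore_max ?gFnormal_trans.
  by rewrite -(isog_sol isoG).
have Kr : 'O_r(K) != 1.
  apply: contraTneq (prime_gt1 r_pr) => Kr1; rewrite -oA cardG_gt1 negbK.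
  by rewrite (isog_eq1 isoA) -subG1 -Kr1 pcore_max.
(* ['O_t(G)] is the [t]-core of ['F(G)], an [s]-group. *)
have Kt : 'O_t(K) = 1.
  apply: (pcore_dprod_p' defK).
    apply: sub_pgroup rA => x; rewrite !inE => /eqP->.
    by rewrite eq_sym; apply/eqP.
  apply/eqP; rewrite -(isog_eq1 (gFisog _ isoG)) /= -p_core_Fitting.
  have t's : t^'.-group 'F(G).
    by apply: sub_pgroup sF => x; rewrite !inE => /eqP->; apply/eqP.
  have cotF := pnat_coprime (pcore_pgroup t 'F(G)) t's.
  by rewrite -subG1 -(coprime_TIg cotF) subsetI subxx pcore_sub.
have [rT [H [cdgH tF ntF isoKH]]] :=
  cdg_extension s_pr r_pr t_pr neq_sr neq_st (fun e => neq_tr (esym e))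
    odd_s odd_t Ks Kr Kt cdgK.
exists rT, H; split=> //.
- rewrite (series_sol (Fitting_normal H)) (nilpotent_sol (Fitting_nil H)).
  rewrite -(isog_sol isoKH) (series_sol nsG) -(isog_sol isoG) solG.
  by rewrite -(dprodW defK) quotientMidl quotient_sol ?abelian_sol.
- apply: fitting_height_extension ntF isoKH _.
  exact: (fitting_height_dprod_abelian defK abA (fitting_height_isog isoG hG)).
- have piF : pi.-group 'F(H) by apply: sub_pgroup tF => x /eqP->.
  rewrite -(pquotient_pgroup piF) ?gFnorm // /pgroup -(card_isog isoKH).
  by rewrite /= cardsX oA pnatM; apply/andP; split=> //; rewrite pnatE.
by split=> //; apply: contraNneq ntF => ->; rewrite gF1.
Qed.

Lemma cdg_tower_cyclic (pi : nat_pred) (s : nat) :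
  prime s -> s \in pi -> cdg_tower pi s 0 (Zp s).
Proof.
move=> s_pr pi_s; have oZ : #|Zp s| = s by rewrite card_Zp ?prime_gt0.
have abZ : abelian (Zp s) by rewrite cyclic_abelian ?prime_cyclic ?oZ.
have ntZ : Zp s != 1 :> {set _} by rewrite -cardG_gt1 oZ prime_gt1.
split.
- exact: abelian_sol.
- exact: cdg_abelian.
- split=> [|[/= Z1|//]].
    apply/fitting_series_quotient => /=.
    by rewrite (nilpotent_Fitting (abelian_nil abZ)) trivg_quotient.
  by case/eqP: ntZ.
- by rewrite /pgroup oZ pnatE.
by rewrite (nilpotent_Fitting (abelian_nil abZ)) /pgroup oZ pnat_id.
Qed.

(** The parity of [n] selects the Fitting prime, starting from the cyclic group of order [p1]. The
    existential is informative, so that the family can be extracted as functions of [n] by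
    projection. *)
Lemma cdg_tower_exists (pi : nat_pred) (p1 p2 r : nat) :
    prime p1 -> prime p2 -> prime r -> p1 <> p2 -> p1 <> r -> p2 <> r ->
    odd p1 -> odd p2 -> p1 \in pi -> p2 \in pi -> r \in pi ->
  forall n, {gT : finGroupType & {G : {group gT} |
    cdg_tower pi (if odd n then p2 else p1) n G}}.
Proof.
move=> p1_pr p2_pr r_pr neq12 neq1r neq2r odd1 odd2 pi1 pi2 pir.
elim=> [|n [gT [G]]]; first by exists 'Z_p1, (Zp p1)%G; exact: cdg_tower_cyclic.
rewrite /=; case: (odd n) => /=.
  exact: (cdg_tower_step p2_pr p1_pr r_pr (fun e => neq12 (esym e))).
exact: (cdg_tower_step p1_pr p2_pr r_pr neq12).
Qed.

Theorem theorem3p4 :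
  exists p1 p2 r : nat,
    [/\ prime p1, prime p2 & prime r] /\
    [/\ p1 <> p2, p1 <> r & p2 <> r] /\
    exists (gT : nat -> finGroupType) (G : forall i : nat, {group gT i}),
      forall i : nat, (1 <= i)%N ->
        [/\ solvable (G i),
            composite_degree_group (G i),
            is_fitting_height (G i) i.+1
          & pgroup (pred3 p1 p2 r) (G i)].
Proof.
exists 3, 5, 2; do 2!split=> //.
have tower := @cdg_tower_exists (pred3 3 5 2) 3 5 2.
have {}tower : forall n, {gT : finGroupType & {G : {group gT} |
    cdg_tower (pred3 3 5 2) (if odd n then 5 else 3) n G}} by exact: tower.
(* Level [i] of the tower has height [i.+1], so no shift of the index is needed. *)
exists (fun i => projT1 (tower i)), (fun i => sval (projT2 (tower i))).
by move=> i _; case: (svalP (projT2 (tower i))).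
Qed.
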